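(* Let $1\leq m\leq k \leq s$, $q\geq 0$, and $0\leq \ell \leq s-1$ be integers. Then $$|\mathsf{CF}^1(q+1,s+1,k+1,\ell,m+1)| = \sum_{i=0}^q(-1)^i\binom{s}{i}\, \Pi^{s-\ell-m}_{-i,\,s-\ell-2-i}\; \Pi^{\ell-(k-m)}_{s-\ell-i,\,s-1-i} \binom{k-1+q-i}{k-1}.$$
   Context: $[s]=\{1,\dots,s\}$. An ordered chain forest of $[s]$ is an ordered partition $\mathcal{F}=\mathsf{B}_1\cdots\mathsf{B}_k$ of $[s]$ into nonempty blocks, where each block is itself internally (linearly) ordered; both orders matter. The first element of a block is its leader. A sequence of blocks is naturally ordered if the blocks are ordered increasingly according to their leaders. The weight $\mathsf{wt}(\mathsf{B})$ of a block is the number of its elements that are less than its leader. Writing out all elements of $\mathcal{F}$ in order gives a sequence of length $s$; the position of an element is its place in this sequence. For $0\le\ell\le s-1$, $\gamma(\mathcal{F},\ell)=|\{j\in[k]:\sum_{i=1}^j|\mathsf{B}_i|>\ell\}|$, the number of blocks whose last element appears after the $\ell$-th position. For integers $2\le m\le k$, $\mathsf{CF}^1(q,s,k,\ell,m)$ is the set of ordered chain forests $\mathcal{F}$ of $[s]$ with $k$ blocks and $\gamma(\mathcal{F},\ell)=m$ such that, writing $\mathcal{F}=\mathsf{B}_1\cdots\mathsf{B}_{k-1}\mathsf{C}_1$: (1) $1\in\mathsf{C}_1$ and $1$ is the leader of $\mathsf{C}_1$; (2) $\sum_{i=1}^{k-1}\mathsf{wt}(\mathsf{B}_i)+|\mathsf{C}_1|=q$;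 (3) the blocks $\mathsf{B}_1,\dots,\mathsf{B}_{k-1}$ are naturally ordered; (4) the leader of the $(k-m+2)$-th block of $\mathcal{F}$ is in the $(\ell+2)$-th position. For integers $a\le b+1$ and $n$, $\Pi^n_{a,b}=\sum_{a\leq i_1<\cdots<i_n\leq b} i_1\cdots i_n$ is the sum of all products of $n$ distinct integers between $a$ and $b$ (inclusive), with $\Pi^0_{a,b}=1$ and $\Pi^n_{a,b}=0$ if $n<0$ or $n>b-a+1$. In particular, for the empty range, $\Pi^0_{a+1,a}=1$ and $\Pi^n_{a+1,a}=0$ for $n\neq 0$. *)

(* Defs.v *)
From HB Require Import structures.
From mathcomp Require Import all_boot all_order all_algebra.

Set Implicit Arguments.
Unset Strict Implicit.
Unset Printing Implicit Defensive.

(* A sequence of blocks B_1 ... B_k is a [seq (seq nat)]; the elements of [s]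
   are the literal integers 1, ..., s. *)
Definition ordered_chain_forest (s : nat) (F : seq (seq nat)) : bool :=
  ([::] \notin F) && perm_eq (flatten F) (iota 1 s).

(* The default 0 is only returned for the empty sequence. *)
Definition leader (B : seq nat) : nat := head 0 B.

Definition naturally_ordered (F : seq (seq nat)) : bool :=
  sorted ltn (map leader F).

Definition wt (B : seq nat) : nat := count (fun x => x < leader B) B.

(* Positions are counted from 1. *)
Definition position (F : seq (seq nat)) (x : nat) : nat :=
  (index x (flatten F)).+1.

Definition gamma (F : seq (seq nat)) (l : nat) : nat :=
  count (fun j => l < sumn (map size (take j F))) (iota 1 (size F)).

(* Blocks are numbered from 1. *)
Definition block (F : seq (seq nat)) (j : nat) : seq nat := nth [::] F j.-1.

(* The conditions defining CF^1(q,s,k,l,m), for 2 <= m <= k. *)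
Definition is_CF1 (q s k l m : nat) (F : seq (seq nat)) : bool :=
  let Bs := take k.-1 F in
  let C1 := block F k in
  [&& ordered_chain_forest s F, size F == k, gamma F l == m
    & [&& leader C1 == 1,
          sumn (map wt Bs) + size C1 == q,
          naturally_ordered Bs
        & position F (leader (block F (k - m + 2))) == l + 2]].

(* Finite encoding: a block of an ordered chain forest of [s] has at most s
   elements, all of which are <= s.  By [decode_inj] and [decode_surj], [decode]
   restricts to a bijection onto the ordered chain forests with k blocks. *)
Definition forest_code (s k : nat) := k.-tuple {bseq s of 'I_s.+1}.

Definition decode (s k : nat) (F : forest_code s k) : seq (seq nat) :=
  [seq [seq val x | x <- bseqval B] | B <- tval F].

Definition CF1 (q s k l m : nat) : {set k.-tuple {bseq s of 'I_s.+1}} :=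
  [set F | is_CF1 q s k l m (decode F)].

Lemma decode_inj s k : injective (@decode s k).
Proof.
move=> F G /inj_map eqFG; apply: val_inj; apply: eqFG => B C eqBC.
by apply: val_inj; apply: (inj_map val_inj) eqBC.
Qed.

Lemma decode_surj s k (F : seq (seq nat)) :
  ordered_chain_forest s F -> size F = k ->
  exists G : forest_code s k, decode G = F.
Proof.
move=> /andP[_ eqF] sizeF.
have memF B x : B \in F -> x \in B -> x < s.+1.
  move=> FB Bx; have : x \in flatten F by apply/flattenP; exists B.
  by rewrite (perm_mem eqF) mem_iota add1n => /andP[].
have sizeB B : B \in F -> size B <= s.
  move=> FB; rewrite -(size_iota 1 s) -(perm_size eqF) size_flatten /shape.
  by rewrite (perm_sumn (perm_map size (perm_to_rem FB))) /= leq_addr.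
pose code (B : seq nat) : {bseq s of 'I_s.+1} :=
  insub_bseq s [seq inord x | x <- B].
have sizeG : size (map code F) == k by rewrite size_map sizeF.
exists (Tuple sizeG); rewrite /decode /= -map_comp.
rewrite -[RHS]map_id; apply/eq_in_map => B FB /=.
rewrite /code /insub_bseq insubdK -?topredE /= ?size_map ?sizeB //.
rewrite -map_comp -[RHS]map_id; apply/eq_in_map => x Bx /=.
by rewrite inordK // (memF B).
Qed.

Import GRing.Theory.
Local Open Scope ring_scope.

(* The number of integers in [a, b]. *)
Definition range_size (a b : int) : nat :=
  if (b - a + 1)%R is Posz N then N else 0%N.

(* Pi^n_{a,b}: the n-subsets of {a, ..., b} are encoded as {a + j | j in A} with
   A an n-subset of {0, ..., b - a}. *)
Definition Pi (n a b : int) : int :=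
  if n is Posz r then
    \sum_(A : {set 'I_(range_size a b)} | #|A| == r)
      \prod_(j in A) (a + (val j)%:Z)
  else 0.

(* Main.v *)
Require Import Defs.
From mathcomp Require Import all_boot all_order all_algebra.
From mathcomp Require Import zify ring.
Set Implicit Arguments.
Unset Strict Implicit.
Unset Printing Implicit Defensive.
Import GRing.Theory.

(** Fix the set of positions at which a new block starts, and let s + 1 be the
    number of elements.  Treating the leader 1 of the last block as larger than
    everything else makes all leaders increase and turns |C_1| - 1 into the
    weight of C_1.  Removing the largest remaining element gives a recursion for
    the weight generating polynomial V of the forests with these block starts.
    The solution is
      (1 - X)^k V = sum_i (-1)^i C(s, i) X^i prod_j (s - i - j),
    where j + 1 runs over the positions that hold no leader: the right-hand side
    satisfies the same recursion because the product over j telescopes when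
    single factors are deleted.  Dividing by (1 - X)^k produces the last
    binomial coefficient, and summing over the block starts with a leader at
    position l + 2 splits the product into the two factors Pi. *)

Local Open Scope ring_scope.

(** * The binomial transform *)

(** With E the shift of [phi] by one, this is (E - X)^n applied to [phi] and evaluated at 0. Its
    recursion in [n] matches the removal of the largest element. *)
Fixpoint binomial_transform (n : nat) (phi : int -> int) : {poly int} :=
  if n is n'.+1 then
    binomial_transform n' (fun z => phi (z + 1)) - 'X * binomial_transform n' phi
  else (phi 0)%:P.
Local Notation T := binomial_transform.

(** The restriction to z <= n matters later, where a falling factorial vanishes only at these
    arguments. *)
Lemma eq_binomial_transform n phi psi :
  (forall z : nat, (z <= n)%N -> phi z%:Z = psi z%:Z) -> T n phi = T n psi.
Proof.
elim: n phi psi => [|n IHn] phi psi eq_pp /=; first by rewrite (eq_pp 0%N).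
congr (_ - _ * _); apply: IHn => z lez; last by rewrite eq_pp // leqW.
by have := eq_pp z.+1; rewrite -addn1 PoszD; apply; rewrite addn1.
Qed.

Lemma binomial_transformD n phi psi :
  T n (fun z => phi z + psi z) = T n phi + T n psi.
Proof.
elim: n phi psi => [|n IHn] phi psi /=; first by rewrite polyCD.
by rewrite !IHn; ring.
Qed.

Lemma binomial_transformZ n a phi : T n (fun z => a * phi z) = a *: T n phi.
Proof.
elim: n phi => [|n IHn] phi /=; first by rewrite polyCM mul_polyC.
by rewrite !IHn scalerBr scalerAr.
Qed.

Lemma binomial_transform_sum n I (r : seq I) (P : pred I) (phi : I -> int -> int) :
  T n (fun z => \sum_(i <- r | P i) phi i z) = \sum_(i <- r | P i) T n (phi i).
Proof.
elim: r => [|i r IHr].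
  rewrite big_nil (eq_binomial_transform (psi := fun z => 0 * 0)) => [|z _].
    by rewrite binomial_transformZ scale0r.
  by rewrite big_nil.
rewrite big_cons; case: ifP => Pi; rewrite -IHr -?binomial_transformD;
  by apply: eq_binomial_transform => z _; rewrite big_cons Pi.
Qed.

Lemma coef_binomial_transform n phi i :
  (T n phi)`_i = (-1) ^+ i * 'C(n, i)%:Z * phi (n%:Z - i%:Z).
Proof.
elim: n phi i => [|n IHn] phi i /=.
  rewrite coefC; case: i => [|i]; first by rewrite !mul1r subr0.
  by rewrite bin0n mulr0 mul0r.
rewrite coefB coefXM IHn; case: i => [|i] /=.
  by rewrite !bin0 subr0; congr (_ * phi _); lia.
rewrite IHn binS PoszD exprS.
have -> : n%:Z - i.+1%:Z + 1 = n.+1%:Z - i.+1%:Z by lia.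
have -> : n%:Z - i%:Z = n.+1%:Z - i.+1%:Z by lia.
ring.
Qed.

(** * Products over the positions without a leader *)

(** A falling factorial from which the factors at the flagged indices are left out. *)
Fixpoint false_prod (z : int) (f : bitseq) : int :=
  if f is b :: f' then (if b then 1 else z) * false_prod (z - 1) f' else 1.

Lemma false_prod_cat z f g :
  false_prod z (f ++ g) = false_prod z f * false_prod (z - (size f)%:Z) g.
Proof.
elim: f z => [|b f IHf] z /=; first by rewrite subr0 mul1r.
rewrite IHf mulrA; congr (_ * false_prod _ g); lia.
Qed.

Definition delete_at (i : nat) (f : bitseq) := take i f ++ drop i.+1 f.

(* The terms are consecutive differences of the products in which [z + 1] is
   replaced by [z] in an initial segment. *)
Lemma sum_false_prod_delete z f :
  \sum_(0 <= i < size f | ~~ nth false f i) false_prod z (delete_at i f)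
  = false_prod (z + 1) f - false_prod z f.
Proof.
elim: f z => [|b f IHf] z /=; first by rewrite big_nil subrr.
rewrite big_mkcond big_nat_recl // -big_mkcond /= addrK.
rewrite -[X in _ + X]/(\sum_(0 <= i < size f | ~~ nth false f i)
   (if b then 1 else z) * false_prod (z - 1) (delete_at i f)).
rewrite -big_distrr /= IHf subrK /delete_at take0 drop1 /=.
by case: b => /=; ring.
Qed.

Lemma false_prod_nseqS z c :
  false_prod z (nseq c.+1 false) = (z - c%:Z) * false_prod z (nseq c false).
Proof.
rewrite -addn1 nseqD false_prod_cat /= size_nseq; ring.
Qed.

Lemma false_prod_nseq_eq0 (z n : nat) :
  (z < n)%N -> false_prod z%:Z (nseq n false) = 0.
Proof.
elim: n => // n IHn; rewrite ltnS leq_eqVlt => /orP[/eqP -> |ltz].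
  by rewrite false_prod_nseqS subrr mul0r.
by rewrite false_prod_nseqS IHn ?mulr0.
Qed.

(** * Words with marked leaders *)

(* A flag [true] marks the start of a block.  [a] is the current leader; the
   part of [v] beyond the length of [h] is ignored. *)
Fixpoint leaders_incr (a : nat) (h : bitseq) (v : seq nat) : bool :=
  match h, v with
  | b :: h', x :: v' =>
    if b then (a < x)%N && leaders_incr x h' v' else leaders_incr a h' v'
  | _, _ => true
  end.

Fixpoint light (a : nat) (h : bitseq) (v : seq nat) : nat :=
  match h, v with
  | b :: h', x :: v' =>
    if b then light x h' v' else ((x < a) + light a h' v')%N
  | _, _ => 0%N
  end.

(** * Insertion of the largest letter *)

Definition insert (M i : nat) (w : seq nat) := take i w ++ M :: drop i w.

(** Insertion is inverted by sending [u] to [rem M u] and [index M u], so every arrangement arises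
    exactly once. *)
Lemma perm_permutations_rcons (M : nat) (s : seq nat) : M \notin s -> uniq s ->
  perm_eq (permutations (rcons s M))
    [seq insert M i w | w <- permutations s, i <- index_iota 0 (size s).+1].
Proof.
move=> Ms Us.
have insP (w : seq nat) (i : nat) : w \in permutations s -> i \in index_iota 0 (size s).+1 ->
    index M (insert M i w) = i /\ rem M (insert M i w) = w.
  rewrite mem_permutations mem_index_iota /= ltnS => eqw lei.
  have Mt : M \notin take i w.
    by apply: contra Ms => /mem_take; rewrite (perm_mem eqw).
  rewrite /insert remE index_cat (negbTE Mt) /= eqxx addn0.
  have szt : size (take i w) = i by rewrite size_takel ?(perm_size eqw).
  rewrite szt -{1}szt take_size_cat ?szt // -cat_rcons drop_size_cat ?cat_take_drop //.
  by rewrite size_rcons szt.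
apply: uniq_perm; first exact: permutations_uniq.
  apply: allpairs_uniq => [||[w i] [w' i']]; rewrite ?permutations_uniq ?iota_uniq //.
  move=> /allpairsP[[w1 i1] [w1s i1s [-> ->]]].
  move=> /allpairsP[[w2 i2] [w2s i2s [-> ->]]] /= eqi.
  have /= [e1 e2] := insP _ _ w1s i1s.
  have /= [e3 e4] := insP _ _ w2s i2s.
  by congr (_, _); [rewrite -e2 eqi | rewrite -e1 eqi].
move=> u; rewrite mem_permutations; apply/idP/allpairsP => [equ|[[w i] /= [ws is_ ->]]].
  have Mu : M \in u by rewrite (perm_mem equ) mem_rcons mem_head.
  exists (rem M u, index M u); split => /=.
  - rewrite mem_permutations -(perm_cons M) -(permPl (perm_to_rem Mu)).
    by rewrite (permPl equ) perm_rcons.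
  - by rewrite mem_index_iota /= -(size_rcons s M) -(perm_size equ) index_mem.
  have lt := Mu; rewrite -index_mem in lt.
  have szt : size (take (index M u) u) = index M u by rewrite size_takel ?index_size.
  rewrite /insert remE -{1}szt take_size_cat // -{1}szt drop_size_cat //.
  by rewrite szt -[X in X :: _](nth_index 0%N Mu) -drop_nth // cat_take_drop.
rewrite mem_permutations in ws.
rewrite perm_sym perm_rcons perm_sym /insert perm_catC cat_cons perm_cons.
by rewrite perm_catC cat_take_drop.
Qed.

Lemma leaders_incr_insert_nonleader M i h a w :
  (i < size h)%N -> ~~ nth false h i -> (size h <= (size w).+1)%N ->
  leaders_incr a h (insert M i w) = leaders_incr a (delete_at i h) w.
Proof.
elim: h i a w => // b h IHh [|i] a w /=.
  by move=> _ /negbTE -> _; rewrite /insert /delete_at !take0 !drop0 /= drop0.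
case: w => [|x w] /= ; first by case: h {IHh}.
by rewrite !ltnS => lti nb les; rewrite -/(insert M i w) -/(delete_at i h) !IHh.
Qed.

(** [M] exceeds the current leader, be it [a] or a letter of [w], and so adds no weight. *)
Lemma light_insert_nonleader M i h a w :
  (i < size h)%N -> ~~ nth false h i -> (size h <= (size w).+1)%N ->
  (a < M)%N -> all (fun x => x < M)%N w ->
  light a h (insert M i w) = light a (delete_at i h) w.
Proof.
elim: h i a w => // b h IHh [|i] a w /=.
  move=> _ /negbTE -> _ ltaM _; rewrite /insert /delete_at !take0 !drop0 /= drop0.
  by rewrite ltnNge ltnW.
case: w => [|x w] /= ; first by case: h {IHh}.
rewrite !ltnS => lti nb les ltaM /andP[ltx allw].
by rewrite -/(insert M i w) -/(delete_at i h) !IHh.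
Qed.

Lemma leaders_incr_nseq a n v : leaders_incr a (nseq n false) v.
Proof. by elim: n v => [|n IHn] [|x v] /=. Qed.

Lemma leaders_incr_false a h v : all (fun x => x <= a)%N v ->
  (size h <= size v)%N -> has id h -> leaders_incr a h v = false.
Proof.
elim: h v => // b h IHh [|x v] //= /andP[lex allv]; rewrite ltnS => les.
by case: b => /= [_|]; [rewrite ltnNge lex | apply: IHh].
Qed.

Lemma light_nseq a n v : all (fun x => x < a)%N v -> (n <= size v)%N ->
  light a (nseq n false) v = n.
Proof.
elim: n v => [|n IHn] [|x v] //= /andP[ltx allv]; rewrite ltnS => les.
by rewrite ltx IHn.
Qed.

Lemma hasN_id_nseq (h : bitseq) : ~~ has id h -> h = nseq (size h) false.
Proof. by elim: h => // -[] //= h IHh /IHh <-. Qed.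

(** No later leader can exceed [M], so [M] must lead the last block; the letters after it are then
    unconstrained. *)
Lemma leaders_incr_insert_leader M i h a w :
  (i < size h)%N -> nth false h i -> (size h <= (size w).+1)%N ->
  (a < M)%N -> all (fun x => x < M)%N w ->
  leaders_incr a h (insert M i w)
  = ~~ has id (drop i.+1 h) && leaders_incr a (take i h) w.
Proof.
elim: h i a w => // b h IHh [|i] a w /=.
  move=> _ -> les ltaM allw; rewrite /insert take0 !drop0 /= ltaM andbT /=.
  have [hash|/hasN_id_nseq ->] /= := boolP (has id h); last exact: leaders_incr_nseq.
  by rewrite leaders_incr_false //; apply: sub_all allw => x /ltnW.
case: w => [|x w] /= ; first by case: h {IHh}.
rewrite !ltnS => lti nb les ltaM /andP[ltx allw].
by rewrite -/(insert M i w) !IHh //; case: b; rewrite // andbCA.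
Qed.

(** All letters after [M] in its block are smaller, so each of the remaining places adds one. *)
Lemma light_insert_leader M i h a w :
  (i < size h)%N -> nth false h i -> (size h <= (size w).+1)%N ->
  all (fun x => x < M)%N w -> ~~ has id (drop i.+1 h) ->
  light a h (insert M i w) = (light a (take i h) w + (size h - i.+1))%N.
Proof.
elim: h i a w => // b h IHh [|i] a w /=.
  move=> _ -> les allw; rewrite /insert take0 !drop0 /= => /hasN_id_nseq hE.
  by rewrite hE light_nseq // size_nseq; lia.
case: w => [|x w] /= ; first by case: h {IHh}.
rewrite !ltnS => lti nb les /andP[ltx allw] nh.
by rewrite -/(insert M i w) !IHh //; case: b; rewrite // addnA.
Qed.

Lemma leaders_incr_take a h v : leaders_incr a h (take (size h) v) = leaders_incr a h v.
Proof.
by elim: h a v => [|b h IHh] a [|x v] //=; rewrite !IHh.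
Qed.

Lemma light_take a h v : light a h (take (size h) v) = light a h v.
Proof.
by elim: h a v => [|b h IHh] a [|x v] //=; rewrite !IHh.
Qed.

(* [h] flags the positions of B_1 ... B_k, and [v] is the word of the forest with
   the leader 1 of C_1 deleted, so that the last [c] letters of [v] are the other
   elements of C_1. *)
Definition forest_poly (h : bitseq) (c : nat) : {poly int} :=
  \sum_(v <- permutations (iota 2 (size h + c)) | leaders_incr 0 h v)
    'X^(light 0 h v + c).

Lemma take_insert_ge M n i w : (n <= i)%N -> (i <= size w)%N ->
  take n (insert M i w) = take n w.
Proof.
move=> leni lei; rewrite /insert takel_cat; last by rewrite size_take_min; lia.
by rewrite take_takel.
Qed.

(* The three terms: the largest element is a non-leader of some B_i; it is the
   leader of B_k, and then the rest of B_k is absorbed by C_1; it lies in C_1. *)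
Lemma forest_poly_rec h c n : (size h + c)%N = n.+1 ->
  forest_poly h c =
    \sum_(0 <= i < size h | ~~ nth false h i) forest_poly (delete_at i h) c
  + \sum_(0 <= i < size h | nth false h i && ~~ has id (drop i.+1 h))
       forest_poly (take i h) (size h - i.+1 + c)
  + c%:R * ('X * forest_poly h c.-1).
Proof.
move=> hcn.
have iotaE : iota 2 (size h + c) = rcons (iota 2 n) n.+2.
  by rewrite hcn -[in LHS](addn1 n) iotaD cats1.
rewrite {1}/forest_poly iotaE.
rewrite (perm_big _ (perm_permutations_rcons _ _)) ?iota_uniq ?mem_iota; last by lia.
rewrite big_mkcond big_allpairs_dep exchange_big /= size_iota.
have -> : \sum_(0 <= i < n.+1) \sum_(w <- permutations (iota 2 n))
   (if leaders_incr 0 h (insert n.+2 i w)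
    then 'X^(light 0 h (insert n.+2 i w) + c) else 0 : {poly int})
 = \sum_(0 <= i < size h + c) \sum_(w <- permutations (iota 2 n))
   (if leaders_incr 0 h (insert n.+2 i w)
    then 'X^(light 0 h (insert n.+2 i w) + c) else 0 : {poly int}) by rewrite hcn.
(* Insertion places before [size h] lie in some B_i, the later ones in C_1. *)
rewrite (big_cat_nat _ (leq_addr c (size h))) //=.
have allM w : w \in permutations (iota 2 n) -> all (fun x => x < n.+2)%N w.
  rewrite mem_permutations => eqw; rewrite (perm_all _ eqw).
  by apply/allP => x; rewrite mem_iota; lia.
have sizew w : w \in permutations (iota 2 n) -> size w = n.
  by rewrite mem_permutations => /perm_size; rewrite size_iota.
congr (_ + _).
  rewrite [in RHS]big_mkcond [X in _ + X]big_mkcond -big_split /=.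
  apply: eq_big_nat => i /andP[_ lti]; case: ifPn => [nb|/negPn nb].
    rewrite (negbTE nb) addr0 /forest_poly.
    have -> : (size (delete_at i h) + c)%N = n.
      rewrite size_cat size_take_min size_drop; lia.
    rewrite [RHS]big_mkcond; apply: eq_big_seq => w w_n /=.
    rewrite leaders_incr_insert_nonleader ?light_insert_nonleader ?allM ?sizew //; lia.
  rewrite nb add0r /=; case: ifP => hasd.
    rewrite /forest_poly size_take_min.
    have -> : (minn i (size h) + (size h - i.+1 + c))%N = n by lia.
    rewrite [RHS]big_mkcond; apply: eq_big_seq => w w_n /=.
    rewrite leaders_incr_insert_leader ?allM ?sizew //; last by lia.
    rewrite hasd /=.
    by case: ifP => // _; rewrite light_insert_leader ?allM ?sizew ?hasd ?addnA //; lia.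
  rewrite big_seq big1 // => w w_n.
  by rewrite leaders_incr_insert_leader ?allM ?sizew ?hasd //; lia.
case: c hcn iotaE => [|c] hcn iotaE; first by rewrite addn0 big_geq // mul0r.
(* Insertion after the first [size h] letters affects neither statistic, so all these places give
   the same summand; the factor ['X] accounts for the shortened C_1. *)
rewrite (eq_big_nat _ _ (F2 := fun=> 'X * forest_poly h c)) => [|i /andP[lei lti]].
  by rewrite big_const_nat iter_addr_0 addKn mulr_natl.
rewrite /forest_poly big_distrr /= [RHS]big_mkcond /=.
have -> : (size h + c = n)%N by lia.
apply: eq_big_seq => w w_n.
rewrite -leaders_incr_take -light_take take_insert_ge ?sizew //; last lia.
by rewrite leaders_incr_take light_take addnS exprS.
by lia.
Qed.

(** * Solution of the recursion *)

(** Flags of a whole forest: [h] for B_1 ... B_k, then the leader 1 of C_1, then its other [c]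
    letters. *)
Definition last_leader_flags (h : bitseq) (c : nat) := h ++ true :: nseq c false.

Lemma false_prod_last_leader z h c :
  false_prod z (last_leader_flags h c)
  = false_prod z h * false_prod (z - (size h)%:Z - 1) (nseq c false).
Proof. by rewrite false_prod_cat /= mul1r. Qed.

Lemma count_delete_at h i : (i < size h)%N -> ~~ nth false h i ->
  count id (delete_at i h) = count id h.
Proof.
move=> lti nb; rewrite -{2}(cat_take_drop i h) (drop_nth false lti).
by rewrite (negbTE nb) !count_cat.
Qed.

(** Only the last flag satisfies the condition. Cutting [h] there exposes the smaller forest that
    remains when B_k is absorbed. *)
Lemma sum_last_true (A : nmodType) (h : bitseq) (G : nat -> A) :
  has id h ->
  exists i, [/\ (i < size h)%N, h = last_leader_flags (take i h) (size h - i.+1)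
   & \sum_(0 <= i < size h | nth false h i && ~~ has id (drop i.+1 h)) G i = G i].
Proof.
elim: h G => // b h IHh G /=.
have [hash _|nhash] := boolP (has id h).
  have [i [lti hE Gi]] := IHh (fun j => G j.+1) hash.
  exists i.+1; split=> //; first by rewrite /= {1}hE.
  by rewrite big_mkcond big_nat_recl // -big_mkcond /= drop0 hash andbF add0r Gi.
rewrite orbF => bT; rewrite bT {b bT}; exists 0%N; split => //.
  by rewrite /last_leader_flags /= subn1 -hasN_id_nseq.
rewrite big_mkcond big_nat_recl // -big_mkcond /= drop0 nhash.
rewrite big_nat_cond big_pred0 ?addr0 // => i; apply/negP=> /andP[/andP[_ lti] /andP[bi _]].
by case/hasP: nhash; exists (nth false h i); rewrite ?mem_nth.
Qed.

Lemma sum_last_true0 (A : nmodType) (h : bitseq) (G : nat -> A) :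
  ~~ has id h ->
  \sum_(0 <= i < size h | nth false h i && ~~ has id (drop i.+1 h)) G i = 0.
Proof.
move=> nhash; rewrite big_nat_cond big_pred0 // => i.
apply/negP=> /andP[/andP[_ lti] /andP[bi _]].
by case/hasP: nhash; exists (nth false h i); rewrite ?mem_nth.
Qed.

(** This is the backward difference of the falling factorial of length [c]. *)
Lemma false_prod_nseq_shift y c :
  false_prod y (nseq c false) - c%:Z * false_prod (y - 1) (nseq c.-1 false)
  = false_prod (y - 1) (nseq c false).
Proof.
case: c => [|c]; first by rewrite mul0r subr0.
rewrite [in RHS]false_prod_nseqS /= -addn1 PoszD; ring.
Qed.

(** Induction on [size h + c], which each term of [forest_poly_rec] lowers by one; the three
    transforms recombine into the defining recursion of [T]. *)
Lemma forest_poly_transform h c :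
  (1 - 'X) ^+ count id h * forest_poly h c
  = T (size h + c) (fun z => false_prod z (last_leader_flags h c)).
Proof.
have [n le_n] := ubnP (size h + c)%N; elim: n => // n IHn in h c le_n *.
case s1: (size h + c)%N => [|s].
  have -> : h = [::] by apply: size0nil; lia.
  have -> : c = 0%N by lia.
  rewrite /forest_poly /= big_seq1 /= ?mulr1 ?mul1r.
  by rewrite expr0.
rewrite (forest_poly_rec s1) !mulrDr 2!big_distrr /=.
(* [A] is the part of the product over [h]; [C] is the part over C_1 with its argument raised by
   one, as after a deletion in [h] or a shift of [z]. *)
pose A z := false_prod z h; pose C z := false_prod (z - (size h)%:Z) (nseq c false).
have -> : \sum_(0 <= i < size h | ~~ nth false h i)
     (1 - 'X) ^+ count id h * forest_poly (delete_at i h) c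
   = T s (fun z => (A (z + 1) - A z) * C z).
  rewrite big_nat_cond (eq_bigr (fun i => T s (fun z => false_prod z (delete_at i h) * C z))).
    rewrite -big_nat_cond -binomial_transform_sum.
    apply: eq_binomial_transform => z _.
    by rewrite -big_distrl /= sum_false_prod_delete.
  move=> i /andP[/andP[_ lti] nb].
  have szd : (size (delete_at i h)).+1 = size h.
    by rewrite size_cat size_take_min size_drop; lia.
  rewrite -(count_delete_at lti nb) IHn; last by lia.
  have -> : (size (delete_at i h) + c = s)%N by lia.
  apply: eq_binomial_transform => z _; rewrite false_prod_last_leader.
  rewrite /C -szd; congr (_ * false_prod _ _); lia.
have -> : \sum_(0 <= i < size h | nth false h i && ~~ has id (drop i.+1 h))
     (1 - 'X) ^+ count id h * forest_poly (take i h) (size h - i.+1 + c)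
   = (1 - 'X) * T s (fun z => A z * C z).
  (* Without a flag in [h] the sum is empty, while [A z * C z] is a falling factorial of length
     [s.+1], zero at z = 0, ..., s. *)
  have [hash|nhash] := boolP (has id h); last first.
    rewrite sum_last_true0 // (eq_binomial_transform (psi := fun z => 0 * 0)).
      by rewrite binomial_transformZ scale0r mulr0.
    move=> z lez; rewrite mulr0 /A /C (hasN_id_nseq nhash) size_nseq.
    have -> : false_prod z (nseq (size h) false) * false_prod (z%:Z - (size h)%:Z) (nseq c false)
         = false_prod z (nseq (size h + c) false).
      by rewrite nseqD false_prod_cat size_nseq.
    by rewrite false_prod_nseq_eq0 // s1 ltnS.
  have [i [lti hE ->]] := sum_last_true
     (fun i => (1 - 'X) ^+ count id h * forest_poly (take i h) (size h - i.+1 + c)) hash.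
  (* The absorbed block loses its flag, which leaves one factor [1 - 'X] over. *)
  have -> : count id h = (count id (take i h)).+1.
    rewrite {1}hE count_cat /=; have -> : count id (nseq (size h - i.+1) false) = 0%N.
      by rewrite count_nseq.
    by rewrite addn0 addn1.
  rewrite exprS -mulrA IHn; last by rewrite size_takel; lia.
  congr (_ * _); rewrite size_takel; last exact: ltnW.
  have -> : (i + (size h - i.+1 + c) = s)%N by lia.
  apply: eq_binomial_transform => z _.
  rewrite /last_leader_flags nseqD -cat_cons catA -/(last_leader_flags _ _) -hE.
  by rewrite false_prod_cat.
have -> : (1 - 'X) ^+ count id h * (c%:R * ('X * forest_poly h c.-1))
   = 'X * T s (fun z => c%:Z * (A z * false_prod (z - (size h)%:Z - 1) (nseq c.-1 false))).
  rewrite binomial_transformZ.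
  case: c => [|c] in le_n s1 A C *; first by rewrite mul0r scale0r !mulr0.
  have sc : (size h + c = s)%N by lia.
  rewrite mulrCA [_ * ('X * _)]mulrCA /= IHn ?sc; last by lia.
  rewrite -mul_polyC mulrCA; congr (_ * _).
  rewrite -[Posz c.+1]natz rmorph_nat; congr (_ * _); apply: eq_binomial_transform => z _.
  by rewrite false_prod_last_leader.
have <- : T s (fun z => A (z + 1) * C z) - T s (fun z => A z * C z)
   = T s (fun z => (A (z + 1) - A z) * C z).
  rewrite -scaleN1r -binomial_transformZ -binomial_transformD.
  by apply: eq_binomial_transform => z _; ring.
(* The shifted half of [T] is [A (z + 1) * C z]; the half multiplied by ['X] splits by
   [false_prod_nseq_shift]. *)
have -> : T s (fun z => false_prod (z + 1) (last_leader_flags h c))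
   = T s (fun z => A (z + 1) * C z).
  apply: eq_binomial_transform => z _; rewrite false_prod_last_leader.
  rewrite /C; congr (_ * false_prod _ _); lia.
have -> : T s (fun z => false_prod z (last_leader_flags h c))
   = T s (fun z => A z * false_prod (z - (size h)%:Z - 1) (nseq c false)).
  by apply: eq_binomial_transform => z _; rewrite false_prod_last_leader.
have -> : T s (fun z => A z * false_prod (z - (size h)%:Z - 1) (nseq c false))
   = T s (fun z => A z * C z)
     - T s (fun z => c%:Z * (A z * false_prod (z - (size h)%:Z - 1) (nseq c.-1 false))).
  rewrite -scaleN1r -binomial_transformZ -binomial_transformD.
  apply: eq_binomial_transform => z _.
  by rewrite -false_prod_nseq_shift /C; ring.
ring.
Qed.

(** * Division by a power of 1 - X *)

(** The series 1/(1 - X)^(k+1) has coefficients C(k + p, k). Each division by 1 - X is a passage to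
    partial sums, and Pascal's rule evaluates them. *)
Lemma coef_div_1subX (k q : nat) (V R : {poly int}) :
  (1 - 'X) ^+ k.+1 * V = R ->
  V`_q = \sum_(0 <= i < q.+1) R`_i * 'C(k + q - i, k)%:Z.
Proof.
have coefS (U : {poly int}) p : U`_p = \sum_(0 <= i < p.+1) ((1 - 'X) * U)`_i.
  have coef1X i : ((1 - 'X) * U)`_i = U`_i - (if i == 0%N then 0 else U`_i.-1).
    by rewrite mulrBl mul1r coefB coefXM.
  elim: p => [|p IHp]; first by rewrite big_nat1 coef1X subr0.
  by rewrite big_nat_recr // -IHp coef1X /= addrC subrK.
elim: k V q => [|k IHk] V q VR.
  rewrite coefS -VR expr1; apply: eq_bigr => i _.
  by rewrite bin0 mulr1.
rewrite exprSr -mulrA in VR; rewrite coefS.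
elim: q => [|q IHq].
  by rewrite !big_nat1 (IHk _ _ VR) big_nat1 !addn0 !subn0 !binn.
rewrite big_nat_recr // IHq (IHk _ _ VR) /= [X in _ + X]big_nat_recr //= [in RHS]big_nat_recr //=.
rewrite addrA -big_split /= !addnK !binn; congr (_ + _).
apply: eq_big_nat => i /andP[_ lti]; rewrite -mulrDr; congr (_ * _).
rewrite -PoszD; congr Posz.
have -> : (k.+1 + q.+1 - i = (k.+1 + q - i).+1)%N by lia.
rewrite binS; congr (_ + 'C(_, _))%N; lia.
Qed.

(** * Chain forests as flagged words *)

Local Open Scope nat_scope.

(** Together with [flatten F] this determines a forest without empty blocks; [chop] inverts the
    pair. *)
Definition flags (F : seq (seq nat)) : bitseq :=
  flatten [seq true :: nseq (size B).-1 false | B <- F].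

Lemma size_flags F : [::] \notin F -> size (flags F) = size (flatten F).
Proof.
elim: F => // -[|x B] F IHF; rewrite inE negb_or //= => /IHF eqs.
by rewrite !size_cat size_nseq eqs.
Qed.

Lemma flags_cat F G : flags (F ++ G) = flags F ++ flags G.
Proof. by rewrite /flags map_cat flatten_cat. Qed.

Lemma count_flags F : count id (flags F) = size F.
Proof.
by elim: F => //= B F IHF; rewrite count_cat -/(flags F) IHF count_nseq.
Qed.

(* The first component is the part of the word before the first flag. *)
Fixpoint chop (f : bitseq) (u : seq nat) : seq nat * seq (seq nat) :=
  match f, u with
  | b :: f', x :: u' =>
    let: (c, F) := chop f' u' in if b then ([::], (x :: c) :: F) else (x :: c, F)
  | _, _ => ([::], [::])
  end.

Lemma chop_flags c F : [::] \notin F ->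
  chop (nseq (size c) false ++ flags F) (c ++ flatten F) = (c, F).
Proof.
move=> nF; elim: c => [|x c IHc] /=; last by rewrite IHc.
elim: F nF => // -[|x B] F IHF; rewrite inE negb_or //= => /IHF eqs.
rewrite -/(flags F); set r := chop _ _.
suff -> : r = (B, F) by [].
by rewrite /r; elim: B {r} => //= y B ->.
Qed.

Lemma chopP f u : size f = size u ->
  [/\ nseq (size (chop f u).1) false ++ flags (chop f u).2 = f,
      (chop f u).1 ++ flatten (chop f u).2 = u & [::] \notin (chop f u).2].
Proof.
elim: f u => [|b f IHf] [|x u] //= [/IHf].
case: (chop f u) => c F /= [<- <- nF].
by case: b; rewrite ?inE.
Qed.

Lemma chop_leader f u : head true f -> (chop f u).1 = [::].
Proof. by case: f u => [|[] f] [|x u] //= _; case: (chop f u). Qed.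

Lemma leaders_incr_block a c h v :
  leaders_incr a (nseq (size c) false ++ h) (c ++ v) = leaders_incr a h v.
Proof. by elim: c. Qed.

Lemma light_block a c h v :
  light a (nseq (size c) false ++ h) (c ++ v) = count (fun x => x < a) c + light a h v.
Proof. by elim: c => //= x c ->; rewrite addnA. Qed.

Lemma leaders_incr_flags a F v : [::] \notin F ->
  leaders_incr a (flags F) (flatten F ++ v) = path ltn a (map leader F).
Proof.
elim: F a => [|[|x B] F IHF] a; rewrite ?inE ?negb_or //=.
by move=> nF; rewrite -/(flags F) -catA leaders_incr_block IHF.
Qed.

Lemma light_flags a F v : [::] \notin F ->
  light a (flags F) (flatten F ++ v) = sumn (map wt F).
Proof.
elim: F a => [|[|x B] F IHF] a; rewrite ?inE ?negb_or //=.
by move=> nF; rewrite -/(flags F) -catA light_block IHF // {2}/wt /= ltnn.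
Qed.

Lemma size_flatten_take_ltn (F : seq (seq nat)) i j : [::] \notin F ->
  i < j -> j <= size F -> size (flatten (take i F)) < size (flatten (take j F)).
Proof.
move=> nF ltij lej; rewrite -(cat_take_drop i (take j F)) take_takel; last exact: ltnW.
rewrite flatten_cat size_cat -[X in X < _]addn0 ltn_add2l.
have : drop i (take j F) != [::].
  by rewrite -size_eq0 size_drop size_takel // subn_eq0 -ltnNge.
have : [::] \notin drop i (take j F).
  by apply: contra nF => /mem_drop /mem_take.
by case: (drop _ _) => // -[|x B] G.
Qed.

(** Ends of nonempty blocks strictly increase, so the blocks counted are those numbered [j] and
    above. *)
Lemma gammaE (F : seq (seq nat)) j l : [::] \notin F -> 0 < j -> j <= size F ->
  size (flatten (take j F)) = l.+1 -> gamma F l = (size F - j).+1.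
Proof.
move=> nF j_gt0 lej sj; rewrite /gamma.
have szF : size F = j.-1 + (size F - j).+1 by lia.
have lo (i : nat) : i \in iota 1 j.-1 -> (l < sumn (map size (take i F))) = pred0 i.
  rewrite mem_iota => ltij; apply/negbTE; rewrite -leqNgt -ltnS -sj.
  rewrite -[sumn _]size_flatten; apply: size_flatten_take_ltn => //.
  lia.
have hi (i : nat) : i \in iota j (size F - j).+1 ->
    (l < sumn (map size (take i F))) = predT i.
  rewrite mem_iota -sj -[sumn _]size_flatten => leji /=.
  have [<-|ltji] : j = i \/ j < i by lia.
    exact: leqnn.
  by apply/ltnW/size_flatten_take_ltn => //; lia.
rewrite [X in iota 1 X]szF iotaD count_cat (eq_in_count lo) count_pred0.
have -> : 1 + j.-1 = j by lia.
by rewrite (eq_in_count hi) count_predT size_iota; lia.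
Qed.

Lemma index_leader (F : seq (seq nat)) j : uniq (flatten F) -> [::] \notin F -> j < size F ->
  index (leader (nth [::] F j)) (flatten F) = size (flatten (take j F)).
Proof.
move=> UF nF ltj; have memF : nth [::] F j \in F by rewrite mem_nth.
have FE : flatten F = flatten (take j F) ++ nth [::] F j ++ flatten (drop j.+1 F).
  by rewrite -{1}(cat_take_drop j F) (drop_nth [::] ltj) flatten_cat.
rewrite {}FE in UF *; case: (nth _ _ _) => [|x B] in memF UF *.
  by rewrite memF in nF.
move: UF; rewrite index_cat cat_uniq /leader /= eqxx addn0 => /and3P[_ nh _].
by rewrite ifN //; apply: contra nh => xt; rewrite xt.
Qed.

Lemma nth_count_take_inj (f : bitseq) p r : nth false f p -> nth false f r ->
  count id (take p f) = count id (take r f) -> p = r.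
Proof.
have lt_take i j : i < j -> nth false f i -> count id (take i f) < count id (take j f).
  move=> ltij fi; have lti : i < size f.
    by rewrite ltnNge; apply/negP => /(nth_default false); rewrite fi.
  rewrite -(cat_take_drop i.+1 (take j f)) take_takel // (take_nth false lti).
  by rewrite count_cat -cats1 count_cat /= fi; lia.
move=> fp fr eqc; case: (ltngtP p r) => // lt.
  by have := lt_take _ _ lt fp; rewrite eqc ltnn.
by have := lt_take _ _ lt fr; rewrite eqc ltnn.
Qed.

(** The start of a block has both properties, and a flagged position is determined by the number of
    flags before it. *)
Lemma block_startE (F : seq (seq nat)) j p : [::] \notin F -> j < size F ->
  (size (flatten (take j F)) == p)
  = nth false (flags F) p && (count id (take p (flags F)) == j).
Proof.
move=> nF ltj; set P := size _.
have nt : [::] \notin take j F by apply: contra nF => /mem_take.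
have ffE : flags F = flags (take j F) ++ flags (drop j F).
  by rewrite -flags_cat cat_take_drop.
have szP : size (flags (take j F)) = P by rewrite size_flags.
have nthP : nth false (flags F) P.
  by rewrite ffE nth_cat szP ltnn subnn (drop_nth [::] ltj).
have countP : count id (take P (flags F)) = j.
  by rewrite ffE -szP take_size_cat // count_flags size_takel // ltnW.
apply/eqP/andP => [<-|[nthp /eqP countp]]; first by rewrite nthP countP.
by apply: (nth_count_take_inj nthP nthp); rewrite countP countp.
Qed.

(** The conditions that involve only block starts. Index [l.+1] is position l + 2, and the
    [(k - m).+1] flags before it make block k - m + 2 start there. *)
Definition good_flags s k l m (f : bitseq) : bool :=
  [&& size f == s.+1, head true f, nth false f l.+1,
      count id (take l.+1 f) == (k - m).+1 & count id f == k.+1].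

Lemma flags_rcons Bs C : flags (rcons Bs (1 :: C)) = last_leader_flags (flags Bs) (size C).
Proof. by rewrite -cats1 flags_cat /= /flags /= cats0. Qed.

Lemma path_leader (F : seq (seq nat)) : [::] \notin F -> 0 \notin flatten F ->
  path ltn 0 (map leader F) = naturally_ordered F.
Proof.
case: F => // -[|x B] F; rewrite inE negb_or //= => _.
by rewrite inE negb_or eq_sym -lt0n /naturally_ordered /= => /andP[-> _].
Qed.

(** Membership separates into a condition on the flags and one on the word without the letter 1; the
    latter is what [forest_poly] counts. *)
Lemma is_CF1_rcons q s k l m (Bs : seq (seq nat)) (C : seq nat) : 0 < m <= k -> [::] \notin Bs ->
  let F := rcons Bs (1 :: C) in
  is_CF1 (q + 1) (s + 1) (k + 1) l (m + 1) F
  = [&& perm_eq (flatten Bs ++ C) (iota 2 s), good_flags s k l m (flags F),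
        leaders_incr 0 (flags Bs) (flatten Bs ++ C)
      & light 0 (flags Bs) (flatten Bs ++ C) + size C == q].
Proof.
move=> mk nBs F; rewrite /is_CF1 /ordered_chain_forest.
have nF : [::] \notin F by rewrite mem_rcons inE.
have fF : flatten F = flatten Bs ++ 1 :: C.
  by rewrite /F -cats1 flatten_cat /= cats0.
have -> : perm_eq (flatten F) (iota 1 (s + 1)) = perm_eq (flatten Bs ++ C) (iota 2 s).
  by rewrite fF perm_catC cat_cons addn1 /= perm_cons perm_catC.
rewrite nF /=; case: (boolP (perm_eq _ _)) => //= eqv.
have UF : uniq (flatten F).
  rewrite fF uniq_catC cat_cons /= uniq_catC.
  rewrite (perm_uniq eqv) iota_uniq mem_cat orbC -mem_cat (perm_mem eqv) mem_iota; lia.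
rewrite leaders_incr_flags // light_flags // addn1 /=.
have headF : head true (flags F).
  by rewrite /F; case: (Bs).
have sizeF : size (flags F) = s.+1.
  have := perm_size eqv; rewrite size_flags // fF !size_cat /= size_iota; lia.
rewrite /good_flags sizeF eqxx headF count_flags /=.
case: (boolP (size F == _)) => [/eqP szF|]; last by rewrite !andbF.
have szBs : size Bs = k by move: szF; rewrite size_rcons => -[].
have -> : take k F = Bs by rewrite /F -cats1 take_size_cat.
have -> : block F k.+1 = 1 :: C by rewrite /block nth_rcons szBs ltnn eqxx.
rewrite /block /=.
(* Block k - m + 2 has index [(k - m).+1] in the list; its start at position l + 2 means that l + 1
   letters precede it. *)
have -> : k.+1 - (m + 1) + 2 = (k - m).+2 by lia.
rewrite /position index_leader //; last by rewrite szF; lia.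
rewrite addn2 eqSS block_startE /=; [|by []|by rewrite szF; lia].
rewrite path_leader //; last first.
  by apply/negP => F0; have := perm_mem eqv 0; rewrite mem_cat F0 mem_iota.
(* The leader of C_1 supplies the extra unit in [q + 1]. *)
rewrite (addn1 q) (addnS (sumn _)) eqSS andbT.
case: (boolP (nth _ _ _ && _)) => [sz|]; last by rewrite !andbF.
rewrite -block_startE ?szF // in sz; last by lia.
(* Block k - m + 1 ends at position l + 1, which gives the value of [gamma]. *)
rewrite (gammaE _ _ _ (eqP sz)) ?szF //; last by lia.
have -> : (k.+1 - (k - m).+1).+1 = m + 1 by lia.
by rewrite eqxx !andbT !andTb andbC.
Qed.

(** * Enumeration of the forests by block starts and words *)

(** This and [before_last_leader] recover [c] and [h] from [last_leader_flags h c]. *)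
Fixpoint trailing_false (f : bitseq) : nat :=
  if f is _ :: f' then (if has id f' then trailing_false f' else size f') else 0.

Definition before_last_leader (f : bitseq) : bitseq :=
  take (size f - (trailing_false f).+1) f.

Lemma trailing_false_last h c : trailing_false (last_leader_flags h c) = c.
Proof.
elim: h => [|b h IHh] /=; last by rewrite has_cat /= orbT.
by case: c => //= c; rewrite has_nseq andbF size_nseq.
Qed.

Lemma before_last_leaderE h c : before_last_leader (last_leader_flags h c) = h.
Proof.
rewrite /before_last_leader trailing_false_last size_cat /= size_nseq addnK.
by rewrite take_size_cat.
Qed.

Lemma last_leader_flagsP f : has id f -> exists h c, f = last_leader_flags h c.
Proof.
elim: f => //= b f IHf; have [/IHf[h [c ->]] _|nf] := boolP (has id f).
  by exists (b :: h), c.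
by rewrite orbF => ->; exists [::], (size f); rewrite /last_leader_flags -hasN_id_nseq.
Qed.

(** Rebuilds a forest: [h] cuts the first letters of [v] into B_1 ... B_k, and 1 is restored as the
    leader of C_1. *)
Definition forest_of (f : bitseq) (v : seq nat) : seq (seq nat) :=
  let h := before_last_leader f in
  rcons (chop h (take (size h) v)).2 (1 :: drop (size h) v).

Definition lists_of_CF1 q s (FL : seq bitseq) : seq (seq (seq nat)) :=
  [seq forest_of f v | f <- FL, v <- [seq v <- permutations (iota 2 s) |
     leaders_incr 0 (before_last_leader f) v &&
     (light 0 (before_last_leader f) v + trailing_false f == q)]].

Lemma good_flagsP s k l m f : good_flags s k l m f ->
  exists h c, [/\ f = last_leader_flags h c, head true h & size h + c = s].
Proof.
case/and5P=> /eqP sf hf fl _ _.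
have [h [c fE]] : exists h c, f = last_leader_flags h c.
  apply/last_leader_flagsP/hasP; exists true => //; rewrite -fl mem_nth //.
  by rewrite ltnNge; apply/negP => /(nth_default false); rewrite fl.
exists h, c; split=> //; first by move: hf; rewrite fE; case: (h).
by move: sf; rewrite fE size_cat /= size_nseq addnS => -[].
Qed.

Lemma forest_of_flagsP h c v : head true h -> size v = size h + c ->
  exists Bs C, [/\ forest_of (last_leader_flags h c) v = rcons Bs (1 :: C),
    [::] \notin Bs, flags Bs = h, size C = c & v = flatten Bs ++ C].
Proof.
move=> hh szv; rewrite /forest_of before_last_leaderE.
have [] := @chopP h (take (size h) v); first by rewrite size_takel // szv leq_addr.
rewrite chop_leader //= => fl vl nB.
exists (chop h (take (size h) v)).2, (drop (size h) v); split=> //.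
  by rewrite size_drop szv addKn.
by rewrite vl cat_take_drop.
Qed.

Lemma mem_lists_of_CF1 q s k l m FL F : 0 < m <= k ->
  FL =i good_flags s k l m ->
  (F \in lists_of_CF1 q s FL) = is_CF1 (q + 1) (s + 1) (k + 1) l (m + 1) F.
Proof.
move=> mk FLE; apply/allpairsPdep/idP => [[f [v []]]|F_CF].
  rewrite FLE mem_filter mem_permutations => gf /andP[okv eqv] ->.
  have [h [c [fE hh szf]]] := good_flagsP gf; rewrite {}fE in gf okv *.
  have szv : size v = size h + c by rewrite (perm_size eqv) size_iota szf.
  have [Bs [C [-> nB flB szC vE]]] := forest_of_flagsP hh szv.
  rewrite before_last_leaderE trailing_false_last in okv.
  by rewrite is_CF1_rcons // flags_rcons flB szC -vE eqv okv andbT; exact: gf.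
(* The last block is nonempty with leader 1, hence of the form [1 :: C]. *)
have [Bs [C [FE nB]]] : exists Bs C, F = rcons Bs (1 :: C) /\ [::] \notin Bs.
  case/and4P: F_CF => /andP[nF _] /eqP szF _ /and4P[ld _ _ _].
  case/lastP: F => [|Bs B] in nF szF ld *; first by rewrite addn1 in szF.
  rewrite mem_rcons inE negb_or in nF; case/andP: nF => nB nBs.
  rewrite /block nth_rcons addn1 /= in ld.
  have szB : size Bs = k by move: szF; rewrite size_rcons addn1 => -[].
  rewrite szB ltnn eqxx in ld; case: B nB ld {szF} => // x C _ /eqP <-.
  by exists Bs, C.
rewrite FE is_CF1_rcons // flags_rcons in F_CF *.
case/and4P: F_CF => eqv gf okv okw.
exists (last_leader_flags (flags Bs) (size C)), (flatten Bs ++ C); split.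
- by rewrite FLE.
- rewrite mem_filter mem_permutations eqv before_last_leaderE trailing_false_last.
  by rewrite okv okw.
rewrite /forest_of before_last_leaderE size_flags // take_size_cat // drop_size_cat //.
by have /= -> := chop_flags [::] nB.
Qed.

(** A forest gives back its flags, and deleting the letter 1 from its flattening gives back its
    word. *)
Lemma uniq_lists_of_CF1 q s k l m FL :
  FL =i good_flags s k l m -> uniq FL -> uniq (lists_of_CF1 q s FL).
Proof.
move=> FLE UFL; apply: allpairs_uniq_dep => // [f _|].
  by rewrite filter_uniq // permutations_uniq.
have inv f v : f \in FL -> v \in permutations (iota 2 s) ->
    flags (forest_of f v) = f /\ rem 1 (flatten (forest_of f v)) = v.
  rewrite FLE mem_permutations => gf eqv.
  have [h [c [fE hh szf]]] := good_flagsP gf; rewrite {}fE in gf *.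
  have szv : size v = size h + c by rewrite (perm_size eqv) size_iota szf.
  have [Bs [C [-> nB flB szC vE]]] := forest_of_flagsP hh szv.
  rewrite flags_rcons flB szC -cats1 flatten_cat /= cats0; split=> //.
  have n1 : 1 \notin flatten Bs.
    apply/negP => B1; have := perm_mem eqv 1.
    by rewrite vE mem_cat B1 mem_iota.
  rewrite remE index_cat (negbTE n1) /= addn0 take_size_cat //.
  by rewrite -cat_rcons drop_size_cat ?size_rcons.
move=> p1 p2 /allpairsPdep[f1 [v1 [f1F v1s ->]]] /allpairsPdep[f2 [v2 [f2F v2s ->]]] /= eqF.
rewrite !mem_filter in v1s v2s; case/andP: v1s => _ v1s; case/andP: v2s => _ v2s.
have [e1 e2] := inv _ _ f1F v1s; have [e3 e4] := inv _ _ f2F v2s.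
have -> : f1 = f2 by rewrite -e1 eqF e3.
by have -> : v1 = v2 by rewrite -e2 eqF e4.
Qed.

Lemma card_CF1 q s k l m FL : 0 < m <= k ->
  FL =i good_flags s k l m -> uniq FL ->
  #|CF1 (q + 1) (s + 1) (k + 1) l (m + 1)| = size (lists_of_CF1 q s FL).
Proof.
move=> mk FLE UFL; rewrite cardE -(size_map (@decode _ _)).
apply/perm_size/uniq_perm.
- by rewrite map_inj_uniq ?enum_uniq //; apply: decode_inj.
- exact: uniq_lists_of_CF1 FLE UFL.
move=> F; rewrite (mem_lists_of_CF1 q F mk FLE); apply/mapP/idP => [[G]|F_CF].
  by rewrite mem_enum inE => GC ->.
have /and3P[ocf /eqP szF _] := F_CF.
have [G GE] := decode_surj ocf szF; exists G => //.
by rewrite mem_enum inE GE.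
Qed.

Local Open Scope ring_scope.

Lemma size_lists_of_CF1 q s k l m FL : FL =i good_flags s k l m ->
  (size (lists_of_CF1 q s FL))%:Z
  = \sum_(f <- FL) (forest_poly (before_last_leader f) (trailing_false f))`_q.
Proof.
move=> FLE; rewrite size_allpairs_dep sumnE big_map.
rewrite (big_morph Posz PoszD (erefl _)).
apply: eq_big_seq => f; rewrite FLE => /good_flagsP[h [c [-> hh szf]]].
rewrite before_last_leaderE trailing_false_last /forest_poly coef_sum szf.
rewrite size_filter -sum1_count (big_morph Posz PoszD (erefl _)) big_mkcondr /=.
by apply: eq_bigr => v _; rewrite coefXn eq_sym; case: eqP.
Qed.

(** * Summation over the block starts *)

(* Positions are reversed because [Pi] lists its factors in increasing order
   whereas the factors of [false_prod] decrease. *)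
Definition bits_of_set n (A : {set 'I_n}) : bitseq :=
  [seq rev_ord j \notin A | j <- enum 'I_n].

(** [A] encodes the unflagged positions, so [t] counts the flags; the additive condition leaves no
    sets when t > n. *)
Definition bits_of_count (n t : nat) : seq bitseq :=
  [seq bits_of_set A | A <- enum [pred A : {set 'I_n} | (#|A| + t)%N == n]].

Lemma size_bits_of_set n (A : {set 'I_n}) : size (bits_of_set A) = n.
Proof. by rewrite size_map size_enum_ord. Qed.

Lemma nth_bits_of_set n (A : {set 'I_n}) (j : 'I_n) :
  nth false (bits_of_set A) j = (rev_ord j \notin A).
Proof. by rewrite (nth_map j) ?size_enum_ord // nth_ord_enum. Qed.

Lemma count_bits_of_set n (A : {set 'I_n}) :
  (#|A| + count id (bits_of_set A) = n)%N.
Proof.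
rewrite count_map -sum1_count big_enum_cond /= (reindex_inj rev_ord_inj) /=.
rewrite -[n in RHS]card_ord -(cardC (mem A)); congr (_ + _)%N.
by rewrite -sum1_card; apply: eq_bigl => j; rewrite /= rev_ordK.
Qed.

Lemma bits_of_set_inj n : injective (@bits_of_set n).
Proof.
move=> A B eqAB; apply/setP => j.
have := congr1 (fun b => nth false b (rev_ord j)) eqAB.
by rewrite !nth_bits_of_set rev_ordK => /negb_inj.
Qed.

Lemma mem_bits_of_count n t g :
  (g \in bits_of_count n t) = (size g == n) && (count id g == t).
Proof.
apply/mapP/andP => [[A]|[/eqP sg /eqP cg]].
  rewrite mem_enum inE => /eqP An ->; rewrite size_bits_of_set eqxx.
  by rewrite -(eqn_add2l #|A|) count_bits_of_set An.
have gE : g = bits_of_set [set j : 'I_n | ~~ nth false g (rev_ord j)].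
  apply: (@eq_from_nth _ false); rewrite ?size_bits_of_set // sg => i lti.
  by rewrite (nth_bits_of_set _ (Ordinal lti)) inE rev_ordK negbK.
exists [set j : 'I_n | ~~ nth false g (rev_ord j)] => //.
by rewrite mem_enum inE -cg [X in count id X]gE count_bits_of_set.
Qed.

Lemma uniq_bits_of_count n t : uniq (bits_of_count n t).
Proof. by rewrite map_inj_uniq ?enum_uniq //; apply: bits_of_set_inj. Qed.

Lemma false_prodE z f :
  false_prod z f = \prod_(0 <= i < size f | ~~ nth false f i) (z - i%:Z).
Proof.
elim: f z => [|b f IHf] z /=; first by rewrite big_nil.
rewrite big_mkcond big_nat_recl // -big_mkcond /= subr0 IHf.
congr (_ * _); first by case: b.
by apply: eq_bigr => i _; lia.
Qed.

(** Choosing the unflagged positions amounts to choosing the factors of a product in [Pi]. *)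
Lemma sum_bits_of_count n t (a b : int) : b - a + 1 = n%:Z ->
  \sum_(g <- bits_of_count n t) false_prod b g = Pi (n%:Z - t%:Z) a b.
Proof.
move=> ban; have rs : range_size a b = n by rewrite /range_size ban.
rewrite big_map big_enum_cond /=.
have prodE (A : {set 'I_n}) :
    false_prod b (bits_of_set A) = \prod_(j in A) (a + (val j)%:Z).
  (* Reversal sends j to n - 1 - j, and b - (n - 1 - j) = a + j. *)
  rewrite false_prodE size_bits_of_set big_mkord (reindex_inj rev_ord_inj).
  apply: eq_big => j; first by rewrite nth_bits_of_set rev_ordK negbK.
  by move=> _ /=; have := ltn_ord j; lia.
rewrite /Pi; case E: (n%:Z - t%:Z) => [r|r].
  rewrite rs; apply: eq_big => [A|A _]; last exact: prodE.
  by rewrite andbT inE; apply/eqP/eqP; move: #|A| => c; lia.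

(* For n < t the value of [Pi] is 0, and no set satisfies the condition. *)
apply: big1 => A; rewrite andbT inE => /eqP; move: #|A| => c; lia.
Qed.

(** Positions 1 and l + 2 start blocks; [k - m] further blocks start between them and [m.-1] after
    them. *)
Definition flag_lists (s k l m : nat) : seq bitseq :=
  [seq true :: g1 ++ true :: g2 | g1 <- bits_of_count l (k - m),
                                 g2 <- bits_of_count (s - l.+1) m.-1].

Lemma mem_flag_lists s k l m : (0 < m <= k)%N -> (l < s)%N ->
  flag_lists s k l m =i good_flags s k l m.
Proof.
move=> mk ltls f; apply/allpairsP/and5P => [[[g1 g2] /= []]|].
  rewrite !mem_bits_of_count => /andP[/eqP s1 /eqP c1] /andP[/eqP s2 /eqP c2] ->.
  rewrite /= nth_cat s1 ltnn subnn size_cat count_cat /= s1 s2 c1 c2 take_size_cat //.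
  by rewrite c1; split=> //; apply/eqP; lia.
case: f => [|b f] [] //= /eqP[sf] -> fl /eqP[ct] /eqP[cf].
have ltlf : (l < size f)%N by rewrite sf.
have fE : f = take l f ++ true :: drop l.+1 f.
  by rewrite -{1}(cat_take_drop l f) (drop_nth false ltlf) fl.
exists (take l f, drop l.+1 f) => /=; rewrite !mem_bits_of_count; split; last by rewrite {1}fE.
  by rewrite size_takel ?(ltnW ltlf) // eqxx; apply/eqP; lia.
rewrite size_drop sf eqxx /=; move: cf; rewrite {1}fE count_cat /= => cf; apply/eqP; lia.
Qed.

Lemma uniq_flag_lists s k l m : uniq (flag_lists s k l m).
Proof.
apply: allpairs_uniq; try exact: uniq_bits_of_count.
move=> p1 p2 /allpairsP[[g1 g2] [g1B g2B ->]] /allpairsP[[h1 h2] [h1B h2B ->]] /=.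
rewrite !mem_bits_of_count in g1B h1B.
case/andP: g1B => /eqP s1 _; case/andP: h1B => /eqP s2 _.
case=> /eqP; rewrite eqseq_cat ?s1 ?s2 // => /andP[/eqP -> /eqP[->]].
by [].
Qed.

(** The two fixed flags contribute no factor; [g1] has the candidates N - 1, ..., N - l and [g2] has
    N - l - 2, ..., N - s. *)
Lemma sum_false_prod_flag_lists s k l m (N : int) : (0 < m <= k)%N -> (l < s)%N ->
  \sum_(f <- flag_lists s k l m) false_prod N f
  = Pi (s%:Z - l%:Z - m%:Z) (N - s%:Z) (N - l%:Z - 2)
    * Pi (l%:Z - (k%:Z - m%:Z)) (N - l%:Z) (N - 1).
Proof.
move=> mk ltls; rewrite big_allpairs_dep /=.
have -> : s%:Z - l%:Z - m%:Z = (s - l.+1)%N%:Z - m.-1%:Z by lia.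
have -> : l%:Z - (k%:Z - m%:Z) = l%:Z - (k - m)%N%:Z by lia.
rewrite -(@sum_bits_of_count (s - l.+1)); last by lia.
rewrite -(@sum_bits_of_count l); last by lia.
rewrite mulrC big_distrl /=; apply: eq_big_seq => g1.
rewrite mem_bits_of_count => /andP[/eqP s1 _]; rewrite big_distrr /=.
apply: eq_bigr => g2 _; rewrite mul1r false_prod_cat /= mul1r s1.
by congr (_ * false_prod _ _); lia.
Qed.

Theorem theorem5p12 (q s k l m : nat)
    (h1m : (1 <= m)%N) (hmk : (m <= k)%N) (hks : (k <= s)%N)
    (hls : (l <= s - 1)%N) :
  #|CF1 (q + 1) (s + 1) (k + 1) l (m + 1)|%:Z =
    \sum_(0 <= i < q.+1)
      (-1) ^+ i * 'C(s, i)%:Z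
      * Pi (s%:Z - l%:Z - m%:Z) (- i%:Z) (s%:Z - l%:Z - 2 - i%:Z)
      * Pi (l%:Z - (k%:Z - m%:Z)) (s%:Z - l%:Z - i%:Z) (s%:Z - 1 - i%:Z)
      * 'C(k - 1 + q - i, k - 1)%:Z.
Proof.
have mk : (0 < m <= k)%N by rewrite h1m.
have ltls : (l < s)%N by lia.
have FLE := mem_flag_lists mk ltls.
rewrite (card_CF1 q mk FLE (uniq_flag_lists _ _ _ _)) (size_lists_of_CF1 q FLE).
(* Coefficient i of the transform times coefficient q - i of 1/(1 - X)^k. *)
pose coef i f := (-1) ^+ i * 'C(s, i)%:Z * false_prod (s%:Z - i%:Z) f
  * 'C(k - 1 + q - i, k - 1)%:Z.
transitivity (\sum_(f <- flag_lists s k l m) \sum_(0 <= i < q.+1) coef i f).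
  apply: eq_big_seq => f; rewrite FLE => gf.
  have [h [c [fE _ szf]]] := good_flagsP gf; move: gf; rewrite fE.
  rewrite before_last_leaderE trailing_false_last => /and5P[_ _ _ _].
  (* One of the k + 1 flags belongs to C_1, so [h] has [k]. *)
  rewrite count_cat /= count_nseq addn0 addn1 eqSS => /eqP hk.
  have := forest_poly_transform h c; rewrite szf hk.
  have -> : k = (k - 1).+1 by lia.
  move/coef_div_1subX => ->; rewrite subn1 /=; apply: eq_big_nat => i _.
  by rewrite coef_binomial_transform /coef subn1.
(* For fixed [i] the sum over block starts factors, with N = s - i. *)
rewrite exchange_big; apply: eq_bigr => i _; rewrite /coef /=.
rewrite -big_distrl -big_distrr /= (sum_false_prod_flag_lists _ mk ltls) !mulrA.
congr (_ * Pi _ _ _ * Pi _ _ _ * _); lia.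
Qed.
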